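(* Let $q\in\kappa$ be generic for $\Gamma$, let $(V,\rho)$ be a finite dimensional representation of $H_q(\Gamma)$, with subspaces $V_i$ and jumping operators $A^i_j:V_i\to V_j$, and let $i\neq j\in I$. (1) If $m_{i,j}$ is odd, then $A^j_iA^i_j$ is diagonalizable with eigenvalues in $\{1\}\cup\{\lambda_{m_{i,j};q}(a):a=1,\dots,[\frac{m_{i,j}-1}{2}]\}$. (2) If $m_{i,j}$ is even, then $A^j_iA^i_j$ is diagonalizable with eigenvalues in $\{1,0\}\cup\{\lambda_{m_{i,j};q}(a):a=1,\dots,[\frac{m_{i,j}-1}{2}]\}$. In addition, if $u\in V_i$ is an eigenvector of $A^j_iA^i_j$ of eigenvalue $0$, then $A^i_j(u)=0$. (3) A nonzero $v\in V_i$ is an eigenvector of $A^j_iA^i_j$ of eigenvalue $1$ if and only if $v\in V_i\cap V_j$.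
   Context: $I$ is a finite set, $\Gamma=[m_{i,j}]_{i,j\in I}$ a Coxeter matrix ($m_{i,i}=1$, $m_{i,j}=m_{j,i}\ge2$ finite integers for $i\ne j$), $\kappa$ a field. The numbers $4\cos^2(a\pi/m)$, $m=m_{i,j}$, are regarded as elements of $\kappa$ (i.e. $2+\zeta^a+\zeta^{-a}$ with $\zeta$ a primitive $m$-th root of unity). $H_q(\Gamma)$ is the $\kappa$-algebra generated by $\sigma_i$ ($i\in I$) with relations $\sigma_i\sigma_j\cdots=\sigma_j\sigma_i\cdots$ ($m_{i,j}$ alternating factors on each side) for $i\neq j$, and $(\sigma_i-q)(\sigma_i+1)=0$. $H_q(I_m)$ denotes this algebra for the dihedral type (two generators, off-diagonal entry $m$). $q\in\kappa\setminus\{0\}$ is generic if $H_q(I_{m_{i,j}})$ is semisimple for all $i\ne j$. Put $\lambda_{m;q}(a)=4\cos^2(a\pi/m)\,\frac{1}{q+q^{-1}+2}$. For a representation $(V,\rho)$ let $V_i$ and $V_i^0$ be the eigenspaces of $\rho(\sigma_i)$ for the eigenvalues $q$ and $-1$; thus $V=V_i\oplus V_i^0$. For $i\ne j$ the jumping operator $A^i_j:V_i\to V_j$ sends $v\in V_i$ to its $V_j$-component in $V=V_j\oplus V_j^0$. *)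

(* Defs.v *)
From HB Require Import structures.
From mathcomp Require Import all_boot all_order all_algebra.
From mathcomp Require Import boolp.
From mathcomp Require Import monalg.

Set Implicit Arguments.
Unset Strict Implicit.
Unset Printing Implicit Defensive.

Import GRing.Theory.

Local Open Scope ring_scope.
Local Open Scope quotient_scope.

Definition coxeter_matrix (I : finType) (M : I -> I -> nat) : Prop :=
  [/\ forall i, M i i = 1%N,
      forall i j, M i j = M j i
    & forall i j, i != j -> (2 <= M i j)%N].

Definition dihedral (m : nat) (i j : bool) : nat := if i == j then 1%N else m.

Fixpoint alternating (R : nzRingType) (n : nat) (x y : R) : R :=
  if n is n'.+1 then x * alternating n' y x else 1.

(* The two-sided ideal generated by S. *)
Inductive ideal_span (R : nzRingType) (S : R -> Prop) : R -> Prop :=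
| ideal_span0 : ideal_span S 0
| ideal_spanMM a s b : S s -> ideal_span S (a * s * b)
| ideal_spanD x y : ideal_span S x -> ideal_span S y -> ideal_span S (x + y).

Section IdealSpan.
Variables (R : nzRingType) (S : R -> Prop).

Lemma ideal_spanM a x b : ideal_span S x -> ideal_span S (a * x * b).
Proof.
elim=> [|c s d Ss|y z _ IHy _ IHz].
- by rewrite mulr0 mul0r; apply: ideal_span0.
- by rewrite !mulrA -[_ * d * b]mulrA; apply: ideal_spanMM.
- by rewrite mulrDr mulrDl; apply: ideal_spanD.
Qed.

Lemma ideal_spanN x : ideal_span S x -> ideal_span S (- x).
Proof. by move/(ideal_spanM (-1) 1); rewrite mulN1r mulr1. Qed.

End IdealSpan.

Section MalgAlgebra.
Variables (K : fieldType) (I : finType).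
Local Notation F := {malg K[{fmonom I}]}.

Fact malg_scaleAr (k : K) (x y : F) : k *: (x * y) = x * (k *: y).
Proof.
have kC (z : F) : k%:MP * z = z * k%:MP.
  rewrite [LHS]fgmulUg [RHS]fgmulgU; apply: eq_bigr => m _.
  by rewrite mul1m mulm1 mulrC.
by rewrite -!mul_malgC mulrA kC mulrA.
Qed.

End MalgAlgebra.

Section HeckeAlgebra.
Variables (K : fieldType) (I : finType) (M : I -> I -> nat) (q : K).

(* The free associative algebra on the generators indexed by I. *)
Local Notation F := {malg K[{fmonom I}]}.

Definition free_gen (i : I) : F := << fmu i >>.

Inductive hecke_relator : F -> Prop :=
| hecke_braid i j : i != j ->
    hecke_relator (alternating (M i j) (free_gen i) (free_gen j)
                   - alternating (M i j) (free_gen j) (free_gen i))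
| hecke_quad i : hecke_relator ((free_gen i - q%:A) * (free_gen i + 1)).

Definition hecke_cong (x y : F) : bool :=
  `[< ideal_span hecke_relator (x - y) >].

Fact hecke_cong_equiv : equiv_class_of hecke_cong.
Proof.
split=> [x|x y|y x z].
- by apply/asboolP; rewrite subrr; apply: ideal_span0.
- by apply: asbool_equiv_eq; split=> /ideal_spanN; rewrite opprB.
- move=> /asboolP xy /asboolP yz; apply/asboolP.
  by rewrite -[x](subrK y) -addrA; apply: ideal_spanD.
Qed.

Canonical hecke_equiv := EquivRelPack hecke_cong_equiv.

Definition hecke : Type := {eq_quot hecke_equiv}.

HB.instance Definition _ := Choice.on hecke.
HB.instance Definition _ := EqQuotient.on hecke.

Local Notation pi := (\pi_hecke).

Lemma hecke_eqP (x y : F) :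
  pi x = pi y <-> ideal_span hecke_relator (x - y).
Proof.
have piP : reflect (pi x = pi y) (hecke_equiv x y) by apply: eqmodP.
by split=> [/piP /asboolP | /asboolP /piP].
Qed.

Definition hecke_add := lift_op2 hecke +%R.
Definition hecke_opp := lift_op1 hecke -%R.
Definition hecke_mul := lift_op2 hecke *%R.
Definition hecke_scale (k : K) := lift_op1 hecke ( *:%R k).

Lemma hecke_repr (x : F) : ideal_span hecke_relator (repr (pi x) - x).
Proof. by apply/hecke_eqP; rewrite reprK. Qed.

Lemma hecke_addE x y : hecke_add (pi x) (pi y) = pi (x + y).
Proof.
rewrite /hecke_add -lock; apply/hecke_eqP; rewrite opprD addrACA.
by apply: ideal_spanD; apply: hecke_repr.
Qed.

Lemma hecke_oppE x : hecke_opp (pi x) = pi (- x).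
Proof.
rewrite /hecke_opp -lock; apply/hecke_eqP; rewrite -opprD.
by apply/ideal_spanN/hecke_repr.
Qed.

Lemma hecke_mulE x y : hecke_mul (pi x) (pi y) = pi (x * y).
Proof.
rewrite /hecke_mul -lock; apply/hecke_eqP.
set x' := repr (pi x); set y' := repr (pi y).
have ->: x' * y' - x * y = 1 * (x' - x) * y' + x * (y' - y) * 1.
  by rewrite mul1r mulr1 mulrBl mulrBr addrA subrK.
by apply: ideal_spanD; apply/ideal_spanM/hecke_repr.
Qed.

Lemma hecke_scaleE k x : hecke_scale k (pi x) = pi (k *: x).
Proof.
rewrite /hecke_scale -lock; apply/hecke_eqP; rewrite -scalerBr.
rewrite -[_ - _]mul1r scalerAl -[_ * _]mulr1.
exact/ideal_spanM/hecke_repr.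
Qed.

Local Ltac lift_free :=
  try red; repeat match goal with |- forall x : hecke, _ => elim/quotW => ? end;
  rewrite ?(hecke_addE, hecke_oppE, hecke_mulE, hecke_scaleE).

Fact hecke_addA : associative hecke_add.
Proof. by lift_free; rewrite addrA. Qed.
Fact hecke_addC : commutative hecke_add.
Proof. by lift_free; rewrite addrC. Qed.
Fact hecke_add0 : left_id (pi 0) hecke_add.
Proof. by lift_free; rewrite add0r. Qed.
Fact hecke_addN : left_inverse (pi 0) hecke_opp hecke_add.
Proof. by lift_free; rewrite addNr. Qed.

HB.instance Definition _ := GRing.isZmodule.Build hecke
  hecke_addA hecke_addC hecke_add0 hecke_addN.

Fact hecke_mulA : associative hecke_mul.
Proof. by lift_free; rewrite mulrA. Qed.
Fact hecke_mul1r : left_id (pi 1) hecke_mul.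
Proof. by lift_free; rewrite mul1r. Qed.
Fact hecke_mulr1 : right_id (pi 1) hecke_mul.
Proof. by lift_free; rewrite mulr1. Qed.
Fact hecke_mulDl : left_distributive hecke_mul hecke_add.
Proof. by lift_free; rewrite mulrDl. Qed.
Fact hecke_mulDr : right_distributive hecke_mul hecke_add.
Proof. by lift_free; rewrite mulrDr. Qed.

(* The algebra is nontrivial: it has the character sigma_i |-> -1. *)
Let sgn (m : {fmonom I}) : K := (-1) ^+ size m.

Fact sgn_mmorphism : mmorphism sgn.
Proof.
split=> [x y|]; rewrite /sgn; last by rewrite fm1.
by rewrite fmM size_cat exprD.
Qed.

HB.instance Definition _ := isMultiplicative.Build _ _ sgn sgn_mmorphism.

Let chi : F -> K := mmap idfun sgn.

Fact hecke_oner_neq0 : pi 1 != pi 0.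
Proof.
have chi1 : chi 1 = 1 by apply: mmap1.
have chiM : {morph chi : x y / x * y} := rmorphM (mmap idfun sgn).
have chiD : {morph chi : x y / x + y} := raddfD (mmap idfun sgn).
have chiB : {morph chi : x y / x - y} := raddfB (mmap idfun sgn).
have chi_gen i : chi (free_gen i) = -1.
  by rewrite /chi mmapU /= mul1r /sgn fmuE expr1.
have chi_alt n k l : chi (alternating n (free_gen k) (free_gen l)) = (-1) ^+ n.
  elim: n k l => [|n IHn] k l /=; first exact: chi1.
  by rewrite chiM chi_gen IHn exprS.
have chi_ideal x : ideal_span hecke_relator x -> chi x = 0.
  elim=> [|a s b Ss|y z _ chi_y _ chi_z].
  - exact: (raddf0 (mmap idfun sgn)).
  - rewrite !chiM; suff -> : chi s = 0 by rewrite mulr0 mul0r.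
    case: Ss => [i j _|i]; first by rewrite chiB !chi_alt subrr.
    by rewrite chiM [chi (_ + 1)]chiD chi1 chi_gen addNr mulr0.
  - by rewrite chiD chi_y chi_z addr0.
apply/eqP => /hecke_eqP; rewrite subr0 => /chi_ideal.
by rewrite chi1 => /eqP; rewrite oner_eq0.
Qed.

HB.instance Definition _ := GRing.Zmodule_isNzRing.Build hecke
  hecke_mulA hecke_mul1r hecke_mulr1 hecke_mulDl hecke_mulDr hecke_oner_neq0.

Fact hecke_scaleA a b (x : hecke) :
  hecke_scale a (hecke_scale b x) = hecke_scale (a * b) x.
Proof. by move: x; lift_free; rewrite scalerA. Qed.
Fact hecke_scale1 : left_id 1 hecke_scale.
Proof. by lift_free; rewrite scale1r. Qed.
Fact hecke_scaleDr : right_distributive hecke_scale hecke_add.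
Proof. by move=> a; lift_free; rewrite scalerDr. Qed.
Fact hecke_scaleDl (x : hecke) :
  {morph hecke_scale^~ x : a b / a + b >-> hecke_add a b}.
Proof. by move: x; lift_free => a b; lift_free; rewrite scalerDl. Qed.

HB.instance Definition _ := GRing.Zmodule_isLmodule.Build K hecke
  hecke_scaleA hecke_scale1 hecke_scaleDr hecke_scaleDl.

Fact hecke_scaleAl a (x y : hecke) :
  hecke_scale a (hecke_mul x y) = hecke_mul (hecke_scale a x) y.
Proof. by move: x y; lift_free; rewrite scalerAl. Qed.

HB.instance Definition _ := GRing.Lmodule_isLalgebra.Build K hecke
  hecke_scaleAl.

Fact hecke_scaleAr a (x y : hecke) :
  hecke_scale a (hecke_mul x y) = hecke_mul x (hecke_scale a y).
Proof. by move: x y; lift_free; rewrite malg_scaleAr. Qed.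

HB.instance Definition _ := GRing.Lalgebra_isAlgebra.Build K hecke
  hecke_scaleAr.

Definition hecke_gen (i : I) : hecke := pi (free_gen i).

End HeckeAlgebra.

Section Semisimple.
Variable A : nzRingType.

Definition left_ideal (L : A -> Prop) : Prop :=
  [/\ L 0, forall x y, L x -> L y -> L (x + y)
    & forall a x, L x -> L (a * x)].

(* The left regular module is semisimple: every submodule is a direct
   summand. *)
Definition semisimple : Prop :=
  forall L, left_ideal L -> exists L',
    [/\ left_ideal L',
        forall x, exists y z, [/\ L y, L' z & x = y + z]
      & forall x, L x -> L' x -> x = 0].

End Semisimple.

Definition generic (K : fieldType) (I : finType) (M : I -> I -> nat) (q : K) :
    Prop :=
  q != 0 /\ forall i j, i != j -> semisimple (hecke (dihedral (M i j)) q).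

(* {lrmorphism A -> 'End(V)} is not available here: 'End(V) is a nonzero ring
   only when V is nonzero, and its ring product in falgebra is the reverse of
   composition. *)
Record representation (K : fieldType) (A : algType K) (V : vectType K) :=
  Representation {
    rep_fun :> {linear A -> 'End(V)};
    rep1 : rep_fun 1 = \1%VF;
    repM : forall x y, rep_fun (x * y) = (rep_fun x \o rep_fun y)%VF
  }.

Definition lfun_diagonalizable (K : fieldType) (V : vectType K)
    (f : 'End(V)) : Prop :=
  exists2 b : seq V, basis_of fullv b
    & forall v, v \in b -> exists a, v \in passmx.leigenspace f a.

Section Jumping.
Variables (K : fieldType) (I : finType) (M : I -> I -> nat) (q : K).
Variables (V : vectType K) (rho : representation (hecke M q) V).

Definition Vq (i : I) : {vspace V} :=
  passmx.leigenspace (rho (hecke_gen M q i)) q.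
Definition VN1 (i : I) : {vspace V} :=
  passmx.leigenspace (rho (hecke_gen M q i)) (-1).

(* jump i j : V_i -> V_j is the projection onto V_j along V_j^0. *)
Definition jump (i j : I) : 'Hom(subvs_of (Vq i), subvs_of (Vq j)) :=
  (linfun (vsproj (Vq j)) \o daddv_pi (Vq j) (VN1 j) \o linfun vsval)%VF.

End Jumping.

(* c a = 4 cos^2 (a pi / m) = 2 + zeta^a + zeta^-a for all a, where zeta, a
   primitive m-th root of unity, may lie in an extension L of K.  Nothing is
   asked when m <= 2: the range 1 <= a <= (m - 1)/2 is then empty, while in
   characteristic 2 there is no primitive square root of unity. *)
Definition four_cos_sq (K : fieldType) (m : nat) (c : nat -> K) : Prop :=
  (2 < m)%N ->
  exists (L : fieldType) (iota : {rmorphism K -> L}) (zeta : L),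
    m.-primitive_root zeta
    /\ forall a, iota (c a) = 2 + zeta ^+ a + zeta ^- a.

(* c m a stands for 4 cos^2 (a pi / m). *)
Definition lambda (K : fieldType) (c : nat -> nat -> K) (m : nat) (q : K)
    (a : nat) : K :=
  c m a * (q + q^-1 + 2)^-1.

(* Main.v *)
From HB Require Import structures.
Require Import Defs.
From mathcomp Require Import all_boot all_order all_algebra.
From mathcomp Require Import monalg ring zify.

(* Let e_i = (sigma_i + 1) / (q + 1) be the projection onto V_i along V_i^0, so
   that A^j_i A^i_j is e_i e_j on V_i.  The element
     theta = 1 - (e_i - e_j)^2
   commutes with e_i and e_j and theta e_i = e_i e_j e_i.  By Cayley-Hamilton for
   sigma_i sigma_j, the differences D_n of the two alternating products with n
   factors satisfy D_(n+4) = tau D_(n+2) - q^2 D_n with tau = (q+1)^2 theta - 2q.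
   Hence D_m is a Chebyshev-like polynomial in theta, with roots lambda(a), times
   D_1 or D_2, and the braid relation D_m = 0 makes
     (theta - 1) theta^[m even] prod_a (theta - lambda(a))
   vanish on V_i.  These factors are distinct, except that some lambda(a) could
   equal 1; semisimplicity excludes Jordan blocks for the eigenvalue 1 and yields
   the remaining claims, as it splits off one-dimensional quotients of the
   submodule generated by a vector of V_i. *)

Set Implicit Arguments.
Unset Strict Implicit.
Unset Printing Implicit Defensive.

Import GRing.Theory.

Local Open Scope ring_scope.

(** * Chebyshev polynomials of the braid relation *)

Section BraidPolynomial.
Variables (K : fieldType) (q : K).

(* With 'X for theta, the trace tau of sigma_i sigma_j on a two-dimensional
   representation, where sigma_i sigma_j has determinant q^2. *)
Definition trace_poly : {poly K} := (q + 1) ^+ 2 *: 'X - (2 * q)%:P.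

Fixpoint cheb2 (n : nat) : {poly K} * {poly K} :=
  if n is n'.+1 then
    let: (u, v) := cheb2 n' in (v, trace_poly * v - q ^+ 2 *: u)
  else (0, 1).

Definition cheb (n : nat) : {poly K} := (cheb2 n).1.

Lemma chebSS n : cheb n.+2 = trace_poly * cheb n.+1 - q ^+ 2 *: cheb n.
Proof. by rewrite /cheb /=; case: (cheb2 n). Qed.

Definition braid_poly (m : nat) : {poly K} :=
  if odd m then cheb (m./2).+1 + q *: cheb m./2 else cheb m./2.

Lemma braid_polyE k : braid_poly k.*2 = cheb k.
Proof. by rewrite /braid_poly odd_double doubleK. Qed.

Lemma braid_polyO k : braid_poly k.*2.+1 = cheb k.+1 + q *: cheb k.
Proof. by rewrite /braid_poly /= odd_double /= uphalf_double. Qed.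

Lemma braid_poly_rec m :
  braid_poly m.+4 = trace_poly * braid_poly m.+2 - q ^+ 2 *: braid_poly m.
Proof.
rewrite /braid_poly /= !negbK; case: (odd m); last exact: chebSS.
rewrite (chebSS m./2.+1) [in q *: cheb m./2.+2]chebSS !scalerBr mulrDr.
rewrite -scalerAr scalerDr opprD addrACA !scalerA.
by rewrite [q * q ^+ 2]mulrC.
Qed.

Hypothesis q1 : q != -1.
Let p_neq0 : q + 1 != 0. Proof. by rewrite addr_eq0. Qed.

Lemma size_trace_poly : size trace_poly = 2.
Proof.
rewrite /trace_poly size_polyDl size_scale ?expf_neq0 ?size_polyX //.
by rewrite size_polyN (leq_ltn_trans (size_polyC_leq1 _)).
Qed.

Lemma size_cheb n : size (cheb n) = n.
Proof.
suff: size (cheb n) = n /\ size (cheb n.+1) = n.+1 by case.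
elim: n => [|n [IHn IHSn]]; first by rewrite /cheb /= size_poly0 size_poly1.
split=> //; rewrite chebSS.
have nz : cheb n.+1 != 0 by rewrite -size_poly_eq0 IHSn.
have szM : size (trace_poly * cheb n.+1) = n.+2.
  by rewrite size_mul -?size_poly_eq0 ?size_trace_poly ?IHSn.
rewrite size_polyDl szM // size_polyN.
by apply: leq_ltn_trans (size_scale_leq _ _) _; rewrite IHn.
Qed.

Lemma size_braid_poly m : (0 < m)%N -> size (braid_poly m) = ((m - 1) %/ 2).+1.
Proof.
rewrite -[m]odd_double_half; case: (odd m) => /=; rewrite ?add1n ?add0n.
  move=> _; rewrite braid_polyO size_polyDl size_cheb ?subn1 /=.
    by rewrite divn2 doubleK.
  by apply: leq_ltn_trans (size_scale_leq _ _) _; rewrite size_cheb.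
case: m./2 => // k _; rewrite braid_polyE size_cheb subn1 /= divn2 /=.
by rewrite uphalf_double.
Qed.

Variables (L : fieldType) (iota : {rmorphism K -> L}).

Lemma map_chebE n (x : K) (s xi : L) : s = iota q -> xi != 0 ->
    iota (trace_poly.[x]) = s * (xi + xi^-1) ->
  s * (xi - xi^-1) * iota (cheb n).[x] = s ^+ n * (xi ^+ n - xi ^- n).
Proof.
move=> def_s xi0 tr_x.
suff: s * (xi - xi^-1) * iota (cheb n).[x] = s ^+ n * (xi ^+ n - xi ^- n) /\
  s * (xi - xi^-1) * iota (cheb n.+1).[x]
  = s ^+ n.+1 * (xi ^+ n.+1 - xi ^- n.+1) by case.
elim: n => [|n [IHn IHSn]].
  rewrite /cheb /= !hornerE rmorph0 rmorph1 !expr1 !expr0 invr1.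
  by split; ring.
split=> //; rewrite chebSS hornerD hornerN hornerM hornerZ rmorphB !rmorphM /=.
rewrite tr_x -def_s -expr2.
rewrite mulrBr mulrCA IHSn [X in _ - X]mulrCA IHn !exprS.
have xin := expf_neq0 n xi0; field; exact/andP.
Qed.

Lemma braid_poly_root (m : nat) (x : K) (xi : L) : q != 0 -> xi != 0 ->
    iota (trace_poly.[x]) = iota q * (xi + xi^-1) ->
  xi ^+ m = 1 -> xi ^+ 2 != 1 -> root (braid_poly m) x.
Proof.
move=> q0 xi0 tr_x xim xi2.
have s0 : iota q * (xi - xi^-1) != 0.
  rewrite mulf_neq0 ?fmorph_eq0 // subr_eq0; apply: contra xi2 => /eqP xiV.
  by rewrite expr2 {1}xiV mulVf.
rewrite rootE -(fmorph_eq0 iota) -(mulrI_eq0 _ (mulfI s0)); apply/eqP.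
have chE n := map_chebE n erefl xi0 tr_x.
move: xim; rewrite -[m]odd_double_half; case: (odd m) => /= xim; last first.
  rewrite add0n braid_polyE chE; apply/eqP; rewrite mulf_eq0; apply/orP; right.
  rewrite subr_eq0 -(inj_eq (mulfI (expf_neq0 m./2 xi0))) divff ?expf_neq0 //.
  by rewrite -exprD addnn xim.
rewrite add1n braid_polyO hornerD hornerZ rmorphD rmorphM /= mulrDr [X in _ + X]mulrCA.
rewrite !chE exprS -mulrA -mulrDr.
have xik := expf_neq0 m./2 xi0; have xik1 := expf_neq0 m./2.+1 xi0.
have -> : xi ^- (m./2).+1 = xi ^+ m./2.
  by apply: (mulfI xik1); rewrite divff // -exprD addSn addnn xim.
have -> : xi ^- m./2 = xi ^+ (m./2).+1.
  by apply: (mulfI xik); rewrite divff // -exprD addnS addnn xim.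
ring.
Qed.

End BraidPolynomial.

Lemma prim_root_exp_eq1 (L : fieldType) (m a : nat) (z : L) :
  m.-primitive_root z -> (0 < a < m)%N -> z ^+ a != 1.
Proof.
move=> prim_z /andP[a0 am]; rewrite -(prim_order_dvd prim_z).
by apply: contraL am => /dvdn_leq; rewrite -leqNgt; apply.
Qed.

Section Lambda.
Variables (K : fieldType) (q : K) (c : nat -> nat -> K) (m : nat).
Hypotheses (q0 : q != 0) (q1 : q != -1) (hc : four_cos_sq m (c m)).

Let p_neq0 : q + 1 != 0. Proof. by rewrite addr_eq0. Qed.
Let half := ((m - 1) %/ 2)%N.

Lemma half_ltn a : (0 < a <= half)%N -> (0 < a.*2 < m)%N.
Proof. rewrite /half; lia. Qed.

Lemma lambdaE a : lambda c m q a = q / (q + 1) ^+ 2 * c m a.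
Proof.
rewrite /lambda mulrC; congr (_ * _).
have -> : q + q^-1 + 2 = (q + 1) ^+ 2 / q by field.
by rewrite invf_div.
Qed.

Lemma trace_poly_lambda a : (trace_poly q).[lambda c m q a] = q * (c m a - 2).
Proof.
rewrite lambdaE /trace_poly hornerD hornerN hornerZ hornerX hornerC.
by field.
Qed.

Lemma primitive_witness a : (0 < a <= half)%N ->
  exists (L : fieldType) (iota : {rmorphism K -> L}) (zeta : L),
    [/\ m.-primitive_root zeta, zeta != 0
      & forall b, iota (c m b) = 2 + zeta ^+ b + zeta ^- b].
Proof.
move=> ha; have m2 : (2 < m)%N by have := half_ltn ha; lia.
have [L [iota [zeta [prim_z cE]]]] := hc m2.
exists L, iota, zeta; split=> //; apply/eqP => z0.
by have := prim_expr_order prim_z; rewrite z0 expr0n gtn_eqF ?(ltn_trans _ m2) //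
  => /esym/eqP; rewrite oner_eq0.
Qed.

Lemma lambda_neq0 a : (0 < a <= half)%N -> lambda c m q a != 0.
Proof.
move=> ha; have [L [iota [z [prim_z z0 cE]]]] := primitive_witness ha.
rewrite lambdaE mulf_neq0 ?mulf_neq0 ?invr_eq0 ?expf_neq0 //.
rewrite -(fmorph_eq0 iota) cE.
have -> : 2 + z ^+ a + z ^- a = (z ^+ a + 1) ^+ 2 / z ^+ a.
  by have ? := expf_neq0 a z0; field.
rewrite mulf_neq0 ?invr_eq0 ?expf_neq0 // addr_eq0.
apply: contra (prim_root_exp_eq1 prim_z (half_ltn ha)) => /eqP za.
by rewrite -addnn exprD za mulrNN mulr1.
Qed.

Lemma lambda_inj :
  {in [pred a | 0 < a <= half]%N &, injective (lambda c m q)}.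
Proof.
move=> a b; rewrite !inE => ha hb.
wlog ab : a b ha hb / (a <= b)%N => [hw|].
  by case: (leqP a b) => [|/ltnW] /hw h /esym; [move/esym/h | move/h]; move=> ->.
have [L [iota [z [prim_z z0 cE]]]] := primitive_witness ha.
rewrite !lambdaE => /mulfI -/(_ _) cab.
have {}cab : c m a = c m b.
  by apply: cab; rewrite mulf_neq0 ?invr_eq0 ?expf_neq0.
move/(congr1 iota): cab; rewrite !cE => zab.
have za := expf_neq0 a z0; have zb := expf_neq0 b z0.
have : (z ^+ b - z ^+ a) * (z ^+ (a + b) - 1) = 0.
  have -> : (z ^+ b - z ^+ a) * (z ^+ (a + b) - 1) = z ^+ a * z ^+ b *
     ((2 + z ^+ b + z ^- b) - (2 + z ^+ a + z ^- a)).
    by rewrite exprD; field; rewrite za zb.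
  by rewrite zab subrr mulr0.
move/eqP; rewrite mulf_eq0 !subr_eq0 (eq_prim_root_expr prim_z).
have := half_ltn ha; have := half_ltn hb => hb2 ha2.
rewrite (negPf (prim_root_exp_eq1 prim_z _)) ?orbF; last by lia.
by rewrite !modn_small; [move/eqP | lia | lia].
Qed.

Lemma braid_poly_factor : (0 < m)%N ->
  braid_poly q m = lead_coef (braid_poly q m) *:
    \prod_(x <- [seq lambda c m q a | a <- iota 1 half]) ('X - x%:P).
Proof.
move=> m0; have inh a : a \in iota 1 half -> (0 < a <= half)%N.
  by rewrite mem_iota add1n ltnS.
apply: all_roots_prod_XsubC.
- by rewrite size_map size_iota size_braid_poly.
- apply/allP => _ /mapP[a /inh ha ->].
  have [L [iota [z [prim_z z0 cE]]]] := primitive_witness ha.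
  have za := expf_neq0 a z0.
  apply: (@braid_poly_root _ _ _ iota _ _ (z ^+ a)) => //.
  + rewrite trace_poly_lambda rmorphM rmorphB /= cE rmorphMn rmorph1.
    by congr (_ * _); ring.
  + by rewrite exprAC (prim_expr_order prim_z) expr1n.
  + by rewrite -exprM muln2 (prim_root_exp_eq1 prim_z) // half_ltn.
- rewrite uniq_rootsE map_inj_in_uniq ?iota_uniq // => a b /inh ha /inh hb.
  exact: lambda_inj.
Qed.

Lemma lead_coef_braid_poly_neq0 : (0 < m)%N -> lead_coef (braid_poly q m) != 0.
Proof. by move=> m0; rewrite lead_coef_eq0 -size_poly_eq0 size_braid_poly. Qed.

End Lambda.

(** * Two generators satisfying the quadratic relation *)

Section TwoGenerators.
Variables (K : fieldType) (A : algType K) (q : K) (x y : A).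
Hypotheses (x_quad : (x - q%:A) * (x + 1) = 0) (y_quad : (y - q%:A) * (y + 1) = 0).

(* [bar u = q u^-1] when u satisfies the quadratic relation. *)
Let bar (u : A) := u - (q - 1)%:A.

Lemma quad_bar (u : A) : (u - q%:A) * (u + 1) = 0 ->
  u * bar u = q%:A /\ bar u * u = q%:A.
Proof.
move=> u_quad; suff uu : u * u = (q - 1) *: u + q%:A.
  by rewrite mulrBr mulrBl mulr_algl mulr_algr uu addrAC subrr add0r.
apply/eqP; rewrite -subr_eq0 -{}u_quad mulrDr mulr1 mulrBl mulr_algl.
by rewrite scalerBl scale1r opprD opprB !addrA [X in X - _ == _]addrAC.
Qed.

Definition braid_trace : A := x * y + bar y * bar x.

Lemma braid_traceC : braid_trace = y * x + bar x * bar y.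
Proof.
have E (u v : A) : u * v + bar v * bar u =
   (u * v + v * u) - ((q - 1) *: (u + v) - (q - 1) *: (q - 1)%:A).
  rewrite /bar !mulrBl !mulrBr !mulr_algl !mulr_algr scalerDr !addrA.
  rewrite opprB -addrA; congr (_ + _).
  by rewrite opprB addrCA -opprD [_ *: v + _]addrC.
by rewrite /braid_trace !E ![y + x]addrC [y * x + _]addrC.
Qed.

Let x_bar := quad_bar x_quad.
Let y_bar := quad_bar y_quad.

Lemma braid_trace_mulx : braid_trace * x = x * y * x + q *: bar y.
Proof. by rewrite mulrDl -[_ * x in X in _ + X]mulrA x_bar.2 mulr_algr. Qed.

Lemma braid_trace_muly : braid_trace * y = y * x * y + q *: bar x.
Proof.
by rewrite braid_traceC mulrDl -[_ * y in X in _ + X]mulrA y_bar.2 mulr_algr.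
Qed.

Lemma bar_barM (u v w : A) : bar u * u = q%:A -> bar v * v = q%:A ->
  bar u * bar v * (v * (u * w)) = q ^+ 2 *: w.
Proof.
move=> uu vv; rewrite -mulrA [bar v * _]mulrA vv mulr_algl -scalerAr mulrA uu.
by rewrite mulr_algl scalerA.
Qed.

Let D n := alternating n x y - alternating n y x.

Lemma alternating_rec n :
  D n.+4 = braid_trace * D n.+2 - q ^+ 2 *: D n.
Proof.
rewrite /D mulrBr {2}braid_traceC {1}/braid_trace /= !scalerBr.
rewrite [(x * y + _) * _]mulrDl [(y * x + _) * _]mulrDl.
rewrite (bar_barM _ x_bar.2 y_bar.2) (bar_barM _ y_bar.2 x_bar.2) -!mulrA.
by rewrite opprD addrACA addrK.
Qed.

Lemma alternating3 : D 3 = (braid_trace + q%:A) * D 1.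
Proof.
rewrite /D /= !mulr1 mulrBr ![(_ + q%:A) * _]mulrDl.
rewrite braid_trace_mulx braid_trace_muly !mulr_algl.
have zE (a b u v k : A) : a - b = a + (u - k) + v - (b + (v - k) + u).
  have e : u - k + v = v - k + u by rewrite addrAC [u + v]addrC addrAC.
  by rewrite -(addrA a) e -(addrA b) opprD addrACA subrr addr0.
rewrite !mulrA /bar !scalerBr.
exact: zE.
Qed.

Lemma sqr_sub_gen : (x - y) * (x - y) = (q ^+ 2 + 1)%:A - braid_trace.
Proof.
have xy : x - y = bar x - bar y by rewrite /bar opprB addrA subrK.
have -> : (x - y) * (x - y) = (2 * q)%:A - (x * bar y + y * bar x).
  rewrite {2}xy mulrBl (mulrBr x (bar x)) (mulrBr y (bar x)).
  rewrite x_bar.1 y_bar.1 opprB addrAC addrA -addrA -opprD.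
  by rewrite mulr_natl mulr2n scalerDl [y * _ + _]addrC.
have -> : x * bar y + y * bar x = braid_trace - ((q - 1) ^+ 2)%:A.
  have -> : x * bar y = bar x * bar y + ((q - 1) *: y - ((q - 1) ^+ 2)%:A).
    by rewrite -{1}[x](subrK (q - 1)%:A) mulrDl mulr_algl scalerBr scalerA.
  rewrite braid_traceC [y * bar x]mulrBr mulr_algr addrACA [_ + y * x]addrC.
  by congr (_ + _); rewrite addrAC subrr add0r.
rewrite opprB addrA -scalerDl; congr (_%:A - _); ring.
Qed.

Lemma quad_succ (u : A) : (u - q%:A) * (u + 1) = 0 ->
  (u + 1) * (u + 1) = (q + 1) *: (u + 1).
Proof.
move=> u_quad; have e : u + 1 = u - q%:A + (q + 1)%:A.
  by rewrite scalerDl scale1r addrA subrK.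
by rewrite [in X in X * _]e mulrDl u_quad add0r mulr_algl.
Qed.

Let X := x + 1.
Let Y := y + 1.
Let XX : X * X = (q + 1) *: X := quad_succ x_quad.
Let YY : Y * Y = (q + 1) *: Y := quad_succ y_quad.

Lemma braid_trace_mul_succ :
  (braid_trace + (2 * q)%:A) * X = X * Y * X.
Proof.
have barx1 : bar x * X = X.
  rewrite mulrDr mulr1 x_bar.2 /bar addrCA -scalerBl opprB addrCA subrr addr0.
  by rewrite scale1r.
have xy1 : x * y + bar y = X * Y - (X + (q - 1)%:A).
  by rewrite [X * Y]mulrDr mulr1 mulrDl mul1r opprD [RHS]addrA addrK -addrA.
rewrite [LHS]mulrDl [braid_trace * X]mulrDl -[bar y * _ * _]mulrA barx1 -mulrDl xy1.
rewrite mulrBl [(X + _) * X]mulrDl XX !mulr_algl -scalerDl -addrA -scaleNr -scalerDl.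
have -> : - (q + 1 + (q - 1)) + 2 * q = 0 by ring.
by rewrite scale0r addr0.
Qed.

Lemma alternating2_mul :
  D 2 * ((q + 1) *: (Y * X) - X * Y * X)
  = (braid_trace + (2 * q)%:A) * ((q ^+ 2 + 1)%:A - braid_trace) * X.
Proof.
have expand (u v : A) : (u + 1) * (v + 1) = u * v + (u + v + 1).
  by rewrite mulrDr mulr1 mulrDl mul1r -!addrA [v + _]addrCA.
have -> : D 2 = X * Y - Y * X.
  by rewrite /D /= !mulr1 !expand opprD addrACA [y + x]addrC subrr addr0.
set S := braid_trace + _.
have -> : (q ^+ 2 + 1)%:A - braid_trace = ((q + 1) ^+ 2)%:A - S.
  rewrite /S (opprD braid_trace) (addrC (- braid_trace)) addrA -scalerBl.
  by congr (_%:A - _); ring.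
have SX : S * X = X * Y * X by apply: braid_trace_mul_succ.
have XYXYX : X * Y * (X * Y * X) = S * (S * X).
  by rewrite SX !mulrA SX.
have XYYX : X * Y * (Y * X) = (q + 1) *: (S * X).
  by rewrite SX -mulrA [Y * (Y * X)]mulrA YY -scalerAl -scalerAr mulrA.
have YXXYX : Y * X * (X * Y * X) = (q + 1) *: (Y * X * (Y * X)).
  by rewrite -!mulrA [X * (X * _)]mulrA XX -scalerAl -scalerAr.
rewrite mulrBr -scalerAr ![(X * Y - Y * X) * _]mulrBl XYYX XYXYX YXXYX.
rewrite scalerBr opprB addrA subrK scalerA -expr2.
by rewrite mulrBr mulr_algr mulrBl -scalerAl mulrA.
Qed.

(* This is [1 - (e - f) ^+ 2] for [e := (x + 1) / (q + 1)], [f := (y + 1) / (q + 1)]. *)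
Definition theta : A := ((q + 1) ^- 2) *: (braid_trace + (2 * q)%:A).

Hypothesis q1 : q != -1.
Let p_neq0 : q + 1 != 0. Proof. by rewrite addr_eq0. Qed.

Lemma horner_theta_trace : horner_alg theta (trace_poly q) = braid_trace.
Proof.
rewrite /trace_poly rmorphB /= linearZ /= horner_algX horner_algC mulr_algl.
rewrite /theta scalerA.
by rewrite divff ?expf_neq0 // scale1r addrK.
Qed.

Lemma horner_theta_braid_poly n : let h m := horner_alg theta (braid_poly q m) in
  h n.*2.+2 * D 2 = D n.*2.+2 /\ h n.*2.+1 * D 1 = D n.*2.+1.
Proof.
move=> h.
have h_rec m : h m.+4 = braid_trace * h m.+2 - q ^+ 2 *: h m.
  rewrite /h braid_poly_rec rmorphB rmorphM /= linearZ /= mulr_algl.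
  by rewrite horner_theta_trace.
have step m E : h m.+2 * E = D m.+2 -> h m * E = D m -> h m.+4 * E = D m.+4.
  by move=> e2 e0; rewrite h_rec mulrBl -mulrA e2 -scalerAl e0 alternating_rec.
have h0 : h 0 = 0 by rewrite /h /braid_poly /= /cheb /= rmorph0.
have h1 : h 1 = 1.
  by rewrite /h /braid_poly /= /cheb /= scaler0 addr0 rmorph1.
have h2 : h 2 = 1 by rewrite /h /braid_poly /= /cheb /= rmorph1.
have h3 : h 3 = braid_trace + q%:A.
  rewrite /h /braid_poly /= /cheb /= scaler0 subr0 mulr1.
  by rewrite rmorphD /= linearZ /= mulr_algl rmorph1 horner_theta_trace.
have D0 : D 0 = 0 by rewrite /D /= subrr.
elim/ltn_ind: n => -[|[|n]] IH.
- by rewrite h2 h1 !mul1r.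
- split; first by apply: (step 0); rewrite ?h2 ?h0 ?mul1r ?mul0r.
  by rewrite h3 alternating3.
- have [|a b] := IH n; first by lia.
  have [|a' b'] := IH n.+1; first by lia.
  by split; apply: step.
Qed.

Lemma theta_mul_succ : theta * X = ((q + 1) ^- 2) *: (X * Y * X).
Proof. by rewrite /theta -scalerAl braid_trace_mul_succ. Qed.

Lemma braid_annihilator m : (2 <= m)%N ->
    alternating m x y = alternating m y x ->
  horner_alg theta (braid_poly q m * 'X ^+ (~~ odd m) * ('X - 1%:P)) * X = 0.
Proof.
move=> m2 braid; have Dm : D m = 0 by rewrite /D braid subrr.
have p2 : (q + 1) ^+ 2 != 0 by rewrite expf_neq0.
have ev1 : (q ^+ 2 + 1)%:A - braid_trace =
    - (q + 1) ^+ 2 *: horner_alg theta ('X - 1%:P).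
  have e : (q ^+ 2 + 1)%:P - trace_poly q = - (q + 1) ^+ 2 *: ('X - 1%:P).
    rewrite /trace_poly scalerBr opprB addrA -polyCD scaleNr scaleNr opprK addrC.
    by congr (_ + _); rewrite -mul_polyC -polyCM; congr (_%:P); ring.
  rewrite -horner_theta_trace -(horner_algC theta) -mulr_algl.
  rewrite -[_%:A * _]/(in_alg A _ * _).
  have := congr1 (horner_alg theta) e.
  by rewrite rmorphB /= linearZ /=.
have ev0 : braid_trace + (2 * q)%:A = (q + 1) ^+ 2 *: horner_alg theta 'X.
  by rewrite horner_algX /theta scalerA divff // scale1r.
move: m2 Dm; rewrite -[m]odd_double_half; case: (odd m); rewrite ?add1n ?add0n.
  move=> _; have [_ <-] := horner_theta_braid_poly m./2.
  rewrite /= odd_double /= expr0 mulr1 rmorphM /= => hD.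
  have := congr1 (fun z => z * (x - y)) hD.
  rewrite mul0r /D /= !mulr1 -[_ * _ * (x - y)]mulrA sqr_sub_gen ev1 -scalerAr => /eqP.
  by rewrite scaler_eq0 oppr_eq0 (negPf p2) => /eqP ->; rewrite mul0r.
case: m./2 => // k _; rewrite doubleS; have [<- _] := horner_theta_braid_poly k.
move=> hD; have -> : ~~ odd k.*2.+2 by rewrite /= negbK odd_double.
have : horner_alg theta (braid_poly q k.*2.+2) * D 2
    * ((q + 1) *: (Y * X) - X * Y * X) = 0 by rewrite hD mul0r.
rewrite -mulrA alternating2_mul ev1 ev0 expr1 !rmorphM /= => /eqP.
rewrite -scalerAr -!scalerAl -!scalerAr !scaler_eq0 oppr_eq0 (negPf p2) /= => /eqP.
by rewrite !mulrA.
Qed.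

End TwoGenerators.

(** * Semisimplicity and the universal property of Hecke algebras *)

Lemma semisimple_split (A : nzRingType) (s t : A) : semisimple A ->
  exists l h k : A, [/\ s * l = 0, t * l = 0 & 1 = h * s + k * t + l].
Proof.
pose J x := exists h k : A, x = h * s + k * t.
have J_ideal : left_ideal J.
  split=> [|x y [h [k ->]] [h' [k' ->]]|a x [h [k ->]]].
  - by exists 0, 0; rewrite !mul0r addr0.
  - by exists (h + h'), (k + k'); rewrite !mulrDl addrACA.
  - by exists (a * h), (a * k); rewrite mulrDr !mulrA.
move/(_ J J_ideal) => [L [[_ _ LM] /(_ 1)[j [l [[h [k def_j]] Ll def1]]] JL0]].
have kill r : J r -> r * l = 0.
  move=> [h' [k' def_r]]; apply: JL0; last exact: LM.
  exists (h' - r * h), (k' - r * k).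
  have -> : l = 1 - j by rewrite def1 addrC addKr.
  rewrite mulrBr mulr1 {1}def_r def_j mulrDr !mulrBl !mulrA opprD addrACA.
  by [].
exists l, h, k; split; last by rewrite -def_j.
  by apply: kill; exists 1, 0; rewrite mul1r mul0r addr0.
by apply: kill; exists 0, 1; rewrite mul1r mul0r add0r.
Qed.

Section HeckeUniversal.
Variables (K : fieldType) (I : finType) (M : I -> I -> nat) (q : K).
Local Notation F := {malg K[{fmonom I}]}.
Local Notation H := (hecke M q).
Local Notation pi := (\pi_(hecke M q)%qT).

Lemma pi_hecke_add (x y : F) : pi (x + y) = pi x + pi y.
Proof. exact: esym (hecke_addE _ _ _ _). Qed.

Lemma pi_hecke_mul (x y : F) : pi (x * y) = pi x * pi y.
Proof. exact: esym (hecke_mulE _ _ _ _). Qed.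

Lemma pi_hecke_scale k (x : F) : pi (k *: x) = k *: pi x.
Proof. exact: esym (hecke_scaleE _ _ _ _). Qed.

Lemma pi_hecke_alternating n (x y : F) :
  pi (alternating n x y) = alternating n (pi x) (pi y).
Proof. by elim: n x y => [|n IHn] x y //=; rewrite pi_hecke_mul IHn. Qed.

Lemma hecke_braidP i j : i != j ->
  alternating (M i j) (hecke_gen M q i) (hecke_gen M q j)
  = alternating (M i j) (hecke_gen M q j) (hecke_gen M q i).
Proof.
move=> ij; rewrite -!pi_hecke_alternating; apply/hecke_eqP.
by rewrite -[_ - _]mul1r -[_ * _]mulr1; apply/ideal_spanMM/hecke_braid.
Qed.

Lemma hecke_quadP i : (hecke_gen M q i - q%:A) * (hecke_gen M q i + 1) = 0.
Proof.
have -> : hecke_gen M q i - q%:A = pi (free_gen K i - q%:A).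
  by rewrite pi_hecke_add -[in RHS]scaleNr pi_hecke_scale scaleNr.
have -> : hecke_gen M q i + 1 = pi (free_gen K i + 1) by rewrite pi_hecke_add.
rewrite -pi_hecke_mul; apply/hecke_eqP; rewrite subr0.
by rewrite -[X in ideal_span _ X]mul1r -[_ * _]mulr1; apply/ideal_spanMM/hecke_quad.
Qed.

Lemma hecke_ind (P : H -> Prop) :
    P 1 -> (forall x y, P x -> P y -> P (x + y)) ->
    (forall k x, P x -> P (k *: x)) ->
    (forall i x, P x -> P (hecke_gen M q i * x)) -> forall x, P x.
Proof.
move=> P1 PD PZ PM; elim/quotW => x; rewrite [x]monalgE.
have P0 : P 0 by rewrite -(scale0r 1); apply: PZ.
elim: (X in \sum_(k <- X) _) => [|m s IHs]; first by rewrite big_nil.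
rewrite big_cons pi_hecke_add; apply: PD => //.
have -> : << x@_m *g m >> = x@_m *: << m >> :> F.
  by apply/malgP => k; rewrite mcoeffZ !mcoeffU mulr_natr.
rewrite pi_hecke_scale; apply: PZ; case: m => w.
elim: w => [|i w IHw]; first by rewrite -fmoneE.
have -> : << FMonom (i :: w) >> = free_gen K i * << FMonom w >> :> F.
  rewrite malgM_def fgmulUU mulr1; congr << _ *g _ >>.
  by apply: val_inj; rewrite /= fmM fmU.
by rewrite pi_hecke_mul; apply: PM.
Qed.

End HeckeUniversal.

Section HeckeLift.
Variables (K : fieldType) (I : finType) (M : I -> I -> nat) (q : K).
Variables (A : algType K) (g : I -> A).
Hypothesis g_braid : forall i j, i != j ->
  alternating (M i j) (g i) (g j) = alternating (M i j) (g j) (g i).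
Hypothesis g_quad : forall i, (g i - q%:A) * (g i + 1) = 0.

Definition word_eval (m : {fmonom I}) : A := \prod_(i <- m) g i.

Fact word_eval_mmorphism : mmorphism word_eval.
Proof.
split=> [x y|]; rewrite /word_eval; last by rewrite fm1 big_nil.
by rewrite fmM big_cat.
Qed.

HB.instance Definition _ := isMultiplicative.Build _ _ word_eval word_eval_mmorphism.

Let ev : {malg K[{fmonom I}]} -> A := mmap (in_alg A) word_eval.

Let evD : {morph ev : x y / x + y}. Proof. exact: mmapD. Qed.
Let evB : {morph ev : x y / x - y}. Proof. exact: mmapB. Qed.
Let evM : {morph ev : x y / x * y}.
Proof.
have scal_comm (f : {malg K[{fmonom I}]}) m m' :
  GRing.comm (in_alg A f@_m) (word_eval m').
  by rewrite /GRing.comm /= mulr_algl mulr_algr.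
by case: (commr_mmap_is_multiplicative scal_comm).
Qed.
Let ev1 : ev 1 = 1. Proof. exact: mmap1. Qed.
Let evZ k : {morph ev : x / k *: x}.
Proof. by move=> x; rewrite /ev mmapZ /= mulr_algl. Qed.
Let ev_gen i : ev (free_gen K i) = g i.
Proof. by rewrite /ev mmapU /= scale1r mul1r /word_eval fmU big_seq1. Qed.

Let ev_alternating n i j :
  ev (alternating n (free_gen K i) (free_gen K j)) = alternating n (g i) (g j).
Proof. by elim: n i j => [|n IHn] i j //=; rewrite evM ev_gen IHn. Qed.

Let ev_ideal x : ideal_span (hecke_relator M q) x -> ev x = 0.
Proof.
elim=> [|a s b Ss|y z _ yE _ zE]; first exact: mmap0.
  rewrite !evM; suff -> : ev s = 0 by rewrite mulr0 mul0r.
  case: Ss => [i j ij|i]; first by rewrite evB !ev_alternating g_braid // subrr.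
  by rewrite evM evB evD evZ ev1 ev_gen g_quad.
by rewrite evD yE zE addr0.
Qed.

Lemma hecke_lift : exists phi : hecke M q -> A,
  [/\ phi 1 = 1, {morph phi : x y / x + y}, {morph phi : x y / x * y},
      forall k, {morph phi : x / k *: x}
    & forall i, phi (hecke_gen M q i) = g i].
Proof.
pose phi (x : hecke M q) := ev (repr x).
have phi_pi x : phi (\pi_(hecke M q)%qT x) = ev x.
  by apply/eqP; rewrite -subr_eq0 -evB; apply/eqP/ev_ideal/hecke_repr.
exists phi; split.
- by rewrite phi_pi ev1.
- by elim/quotW => x; elim/quotW => y; rewrite -pi_hecke_add !phi_pi evD.
- by elim/quotW => x; elim/quotW => y; rewrite -pi_hecke_mul !phi_pi evM.
- by move=> k; elim/quotW => x; rewrite -pi_hecke_scale !phi_pi evZ.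
- by move=> i; rewrite phi_pi ev_gen.
Qed.

End HeckeLift.

(** * Diagonalizable endomorphisms *)

Section Diagonalization.
Variables (K : fieldType) (V : vectType K).

Lemma span_sub_basis (s : seq V) :
  exists2 b, {subset b <= s} & basis_of <<s>>%VS b.
Proof.
elim: s => [|v s [b b_s /andP[/eqP span_b free_b]]].
  by exists [::]; rewrite // /basis_of eqxx nil_free.
have [v_s | v_s] := boolP (v \in <<s>>%VS).
  exists b; first by move=> w /b_s ws; rewrite inE ws orbT.
  rewrite /basis_of free_b andbT span_b span_cons eq_sym; apply/eqP/addv_idPr.
  by rewrite -memvE.
exists (v :: b).
  by move=> w; rewrite !inE => /orP[-> // | /b_s ->]; rewrite orbT.
by rewrite /basis_of !span_cons span_b eqxx free_cons free_b span_b v_s.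
Qed.

Variable f : 'End(V).

Lemma mem_leigenspace a v : (v \in passmx.leigenspace f a) = (f v == a *: v).
Proof. by rewrite memv_ker !lfun_simp subr_eq0. Qed.

Definition kill (rs : seq K) (v : V) : V := foldl (fun w r => f w - r *: w) v rs.

Lemma sum_leigenspace_preim (rs : seq K) r v : r \notin rs ->
    v \in (\sum_(a <- rs) passmx.leigenspace f a)%VS ->
  exists2 w, w \in (\sum_(a <- rs) passmx.leigenspace f a)%VS & f w - r *: w = v.
Proof.
elim: rs v => [v _ | a rs IHrs v].
  by rewrite big_nil memv0 => /eqP->; exists 0; rewrite ?mem0v // linear0 scaler0 subr0.
rewrite inE negb_or big_cons => /andP[ra r_rs] /memv_addP[u u_a [v' v'_rs ->]].
have [w w_rs fw] := IHrs _ r_rs v'_rs.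
have ar0 : a - r != 0 by rewrite subr_eq0 eq_sym.
exists ((a - r)^-1 *: u + w); first by rewrite memv_add ?memvZ.
have /eqP fu : f u == a *: u by rewrite -mem_leigenspace.
rewrite linearD linearZ /= fu scalerDr opprD addrACA fw scalerA [r *: _]scalerA.
by rewrite [r * _]mulrC -scalerBl -mulrBr mulVf // scale1r.
Qed.

Lemma kill_sum_eigenspaces (rs : seq K) (v : V) : uniq rs -> kill rs v = 0 ->
  v \in (\sum_(r <- rs) passmx.leigenspace f r)%VS.
Proof.
elim: rs v => [v _ /= -> | r rs IHrs v /= /andP[r_rs Urs] kv]; first exact: mem0v.
have [w w_rs fw] := sum_leigenspace_preim r_rs (IHrs _ Urs kv).
rewrite big_cons -[v](subrK w) memv_add // mem_leigenspace linearB scalerBr /=.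
by rewrite -[f v](subrK (r *: v)) -fw addrAC [X in X + _]addrAC subrr add0r addrC.
Qed.

Lemma kill_diagonalizable (rs : seq K) :
  uniq rs -> (forall v, kill rs v = 0) -> lfun_diagonalizable f.
Proof.
move=> Urs k0.
pose s := flatten [seq vbasis (passmx.leigenspace f r) : seq V | r <- rs].
have [b b_s b_basis] := span_sub_basis s.
exists b.
  suff <- : <<s>>%VS = fullv by [].
  apply/eqP; rewrite eqEsubv subvf; apply/subvP => v _.
  have := kill_sum_eigenspaces Urs (k0 v).
  rewrite /s; elim: (rs) v => [|r rs' IH] v /=.
    by rewrite big_nil span_nil.
  rewrite big_cons span_cat (span_basis (vbasisP _)) => /memv_addP[u u_r [w w_rs' ->]].
  by apply: memv_add => //; apply: IH.
move=> v /b_s /flatten_mapP[r r_rs v_r]; exists r; exact: vbasis_mem.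
Qed.

Lemma kill_eigen (rs : seq K) (v : V) a : f v = a *: v ->
  kill rs v = (\prod_(r <- rs) (a - r)) *: v.
Proof.
move=> fv; suff k_scale b : kill rs (b *: v) = (b * \prod_(r <- rs) (a - r)) *: v.
  by rewrite -{1}[v]scale1r k_scale mul1r.
elim: rs b => [|r rs IHrs] b; first by rewrite big_nil mulr1.
rewrite big_cons /kill /= linearZ /= fv !scalerA -scalerBl -/(kill rs _).
by rewrite [r * b]mulrC -mulrBr IHrs mulrA.
Qed.

Lemma kill_leigenvalue (rs : seq K) a :
  (forall v, kill rs v = 0) -> passmx.leigenvalue f a -> a \in rs.
Proof.
rewrite /passmx.leigenvalue => k0; rewrite -vpick0; set v := vpick _ => v0.
have fv : f v = a *: v by apply/eqP; rewrite -mem_leigenspace memv_pick.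
have /eqP := kill_eigen rs fv; rewrite k0 eq_sym scaler_eq0 (negPf v0) orbF.
by rewrite prodf_seq_eq0 => /hasP[r r_rs]; rewrite subr_eq0 => /eqP ->.
Qed.

Lemma kill_cons r rs v : kill (r :: rs) v = kill rs (f v - r *: v).
Proof. by []. Qed.

Lemma kill_rcons rs r v : kill (rcons rs r) v = f (kill rs v) - r *: kill rs v.
Proof. by rewrite /kill foldl_rcons. Qed.

End Diagonalization.

(** * Jumping operators *)

Lemma semisimple_dihedral_neqN1 (K : fieldType) (m : nat) (q : K) :
  semisimple (hecke (dihedral m) q) -> q != -1.
Proof.
move=> ss; apply/eqP => qN1.
pose N : 'M[K]_2 := delta_mx 0 1.
have NN : N * N = 0 by rewrite -[N * N]/(N *m N) mul_delta_mx_cond.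
have [||phi [phi1 phiD phiM phiZ phi_gen]] :=
  @hecke_lift K bool (dihedral m) q 'M[K]_2 (fun=> N - 1).
- by [].
- by move=> _; rewrite qN1 scaleN1r opprK !subrK NN.
have phiC h : phi h * N = N * phi h.
  elim/hecke_ind: h => [|x y Cx Cy|k x Cx|b x Cx].
  - by rewrite phi1 mul1r mulr1.
  - by rewrite phiD mulrDl mulrDr Cx Cy.
  - by rewrite phiZ -scalerAl -scalerAr Cx.
  - by rewrite phiM phi_gen -mulrA Cx !mulrA mulrBl mulrBr mul1r mulr1.
pose s b := hecke_gen (dihedral m) q b + 1.
have [l [h [k [sl _ one]]]] := semisimple_split (s true) (s false) ss.
have phi_s b : phi (s b) = N by rewrite phiD phi1 phi_gen subrK.
have phi0 : phi 0 = 0 by apply: (addIr (phi 0)); rewrite -phiD !add0r.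
have : N = 0.
  rewrite -[N]mulr1 -phi1 one !phiD !phiM !phi_s !phiC -(phi_s true).
  rewrite mulrDr -[X in _ + X]phiM sl.
  by rewrite phi0 addr0 phi_s mulrDr !mulrA NN !mul0r addr0.
by move/matrixP/(_ 0 1); rewrite !mxE /= => /eqP; rewrite oner_eq0.
Qed.

Section Representation.
Variables (K : fieldType) (I : finType) (M : I -> I -> nat) (q : K).
Variables (V : vectType K) (rho : representation (hecke M q) V).
Hypothesis q1 : q != -1.
Let p_neq0 : q + 1 != 0. Proof. by rewrite addr_eq0. Qed.

Local Notation gen := (hecke_gen M q).

Let rhoM x y v : rho (x * y) v = rho x (rho y v).
Proof. by rewrite repM lfunE. Qed.
Let rho_1 v : rho 1 v = v. Proof. by rewrite rep1 lfunE. Qed.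
Let rhoD x y v : rho (x + y) v = rho x v + rho y v.
Proof. by rewrite linearD lfunE. Qed.
Let rhoZ k x v : rho (k *: x) v = k *: rho x v.
Proof. by rewrite linearZ lfunE. Qed.
Let rhoB x y v : rho (x - y) v = rho x v - rho y v.
Proof. by rewrite rhoD -scaleN1r rhoZ scaleN1r. Qed.
Let rho0 v : rho 0 v = 0. Proof. by rewrite linear0 lfunE. Qed.

Definition proj_gen (k : I) (v : V) : V := (q + 1)^-1 *: (rho (gen k) v + v).
Local Notation E := proj_gen.

Lemma rho_proj_gen k v : rho (gen k) v = (q + 1) *: E k v - v.
Proof. by rewrite /proj_gen scalerA divff // scale1r addrK. Qed.

Let rho_quad k v : rho (gen k) (rho (gen k) v) = (q - 1) *: rho (gen k) v + q *: v.
Proof.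
have /eqP := congr1 (fun z => rho z v) (hecke_quadP M q k).
rewrite rho0 rhoM (rhoB (gen k) q%:A) (rhoZ q 1) rho_1 (rhoD (gen k) 1) rho_1.
rewrite linearD /= scalerDr.
by rewrite subr_eq0 => /eqP e; apply: (addIr (rho (gen k) v)); rewrite e
  scalerBl scale1r addrAC subrK.
Qed.

Lemma proj_gen_id k v : (v \in Vq rho k) = (E k v == v).
Proof.
have e : q *: v + v = (q + 1) *: v by rewrite scalerDl scale1r.
rewrite mem_leigenspace rho_proj_gen subr_eq e.
by rewrite (inj_eq (scalerI p_neq0)).
Qed.

Lemma proj_gen_mem k v : E k v \in Vq rho k.
Proof.
rewrite mem_leigenspace /proj_gen linearZ linearD /= rho_quad scalerA mulrC -scalerA.
rewrite addrAC scalerDr scalerBl scale1r subrK.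
by rewrite !scalerDr.
Qed.

Lemma proj_genK k v : E k (E k v) = E k v.
Proof. by apply/eqP; rewrite -proj_gen_id proj_gen_mem. Qed.

Lemma proj_genD k v w : E k (v + w) = E k v + E k w.
Proof. by rewrite /proj_gen -scalerDr addrACA (linearD (rho (gen k))). Qed.

Lemma proj_genZ k a v : E k (a *: v) = a *: E k v.
Proof. by rewrite /proj_gen (linearZ_LR (rho (gen k))) -scalerDr !scalerA mulrC. Qed.

Lemma proj_genB k v w : E k (v - w) = E k v - E k w.
Proof. by rewrite -scaleN1r proj_genD proj_genZ scaleN1r. Qed.

Lemma rho_eigen_proj k v a :
  (rho (gen k) v == a *: v) = (E k v == ((a + 1) / (q + 1)) *: v).
Proof.
have e : a *: v + v = (a + 1) *: v by rewrite scalerDl scale1r.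
rewrite rho_proj_gen subr_eq e.
by rewrite [_ / _]mulrC -scalerA (can2_eq (scalerK p_neq0) (scalerKV p_neq0)).
Qed.

Lemma proj_gen_eq0 k v : (v \in VN1 rho k) = (E k v == 0).
Proof. by rewrite mem_leigenspace rho_eigen_proj addNr mul0r scale0r. Qed.

Lemma jumpE k l (u : subvs_of (Vq rho k)) : vsval (jump rho k l u) = E l (vsval u).
Proof.
have cap0 : (Vq rho l :&: VN1 rho l = 0)%VS.
  apply/eqP; rewrite -subv0; apply/subvP => v.
  rewrite memv_cap proj_gen_id proj_gen_eq0.
  by case/andP => /eqP {2}<- /eqP->; rewrite memv0.
rewrite /jump !lfunE /= !lfunE /= !lfunE /= vsprojK ?memv_pi //.
set v := vsval u.
have v_ker : v - E l v \in VN1 rho l by rewrite proj_gen_eq0 proj_genB proj_genK subrr.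
have v_sum : v \in (Vq rho l + VN1 rho l)%VS.
  by rewrite -[v](subrK (E l v)) addrC memv_add ?proj_gen_mem.
rewrite -[in RHS](daddv_pi_add cap0 v_sum) proj_genD.
have /eqP -> : E l (daddv_pi (VN1 rho l) (Vq rho l) v) == 0.
  by rewrite -proj_gen_eq0 memv_pi.
by rewrite addr0; apply/esym/eqP; rewrite -proj_gen_id memv_pi.
Qed.

Lemma rho_succ k v : rho (gen k + 1) v = (q + 1) *: E k v.
Proof. by rewrite rhoD rho_1 rho_proj_gen subrK. Qed.

Variables i j : I.
Hypotheses (ij : i != j) (Mij : M j i = M i j).
Hypothesis ss : semisimple (hecke (dihedral (M i j)) q).

Lemma rep_split (a b : K) : exists l h k : V -> V,
  [/\ forall v, rho (gen i) (l v) = a *: l v,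
      forall v, rho (gen j) (l v) = b *: l v,
      forall v, v = h (rho (gen i) v - a *: v) + k (rho (gen j) v - b *: v) + l v
    & forall N : {vspace V},
        {in N, forall v, rho (gen i) v \in N} ->
        {in N, forall v, rho (gen j) v \in N} ->
        {in N, forall v, h v \in N /\ k v \in N}].
Proof.
pose g (c : bool) := gen (if c then i else j).
have [||phi [phi1 phiD phiM phiZ phi_gen]] :=
  @hecke_lift K bool (dihedral (M i j)) q (hecke M q) g.
- move=> [] [] // _; first exact: (hecke_braidP M q ij).
  by rewrite -[dihedral _ _ _]Mij; apply: hecke_braidP; rewrite eq_sym.
- by move=> c; apply: hecke_quadP.
have [l [h [k [sl tl one]]]] := semisimple_split
  (hecke_gen _ q true - a%:A) (hecke_gen _ q false - b%:A) ss.
have phi0 : phi 0 = 0 by apply: (addIr (phi 0)); rewrite -phiD !add0r.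
have phi_sub c d x : phi ((hecke_gen _ q c - d%:A) * x) = (g c - d%:A) * phi x.
  by rewrite phiM phiD -scaleN1r !phiZ phi1 phi_gen scaleN1r.
exists (rho (phi l)), (rho (phi h)), (rho (phi k)); split.
- move=> v; apply/eqP; rewrite -subr_eq0 -[in X in _ - X](rho_1 (rho (phi l) v)).
  by rewrite -rhoZ -rhoB -rhoM -(phi_sub true) sl phi0 rho0.
- move=> v; apply/eqP; rewrite -subr_eq0 -[in X in _ - X](rho_1 (rho (phi l) v)).
  by rewrite -rhoZ -rhoB -rhoM -(phi_sub false) tl phi0 rho0.
- move=> v; pose s := hecke_gen (dihedral (M i j)) q true - a%:A.
  pose t := hecke_gen (dihedral (M i j)) q false - b%:A.
  have e x c d :
      rho (phi (x * (hecke_gen _ q c - d%:A))) v = rho (phi x) (rho (g c) v - d *: v).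
    by rewrite phiM rhoM -[_ - _]mulr1 phi_sub phi1 mulr1 rhoB rhoZ rho_1.
  transitivity (rho (phi (h * s)) v + rho (phi (k * t)) v + rho (phi l) v).
    by rewrite -!rhoD -!phiD -one phi1 rho_1.
  by congr (_ + _ + _); exact: e.
- move=> N Ni Nj v Nv.
  suff st x w : w \in N -> rho (phi x) w \in N by split; apply: st.
  elim/hecke_ind: x w => [|x y IHx IHy|c x IHx|c x IHx] w Nw.
  + by rewrite phi1 rho_1.
  + by rewrite phiD rhoD memvD ?IHx ?IHy.
  + by rewrite phiZ rhoZ memvZ ?IHx.
  + by rewrite phiM rhoM phi_gen /g; case: c; [apply: Ni | apply: Nj]; apply: IHx.
Qed.

Lemma rep_split_line (n u v : V) (a b : K) :
    (forall k, k \in [:: i; j] -> E k n \in (<[n]> + <[u]>)%VS) ->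
    (forall k, k \in [:: i; j] -> E k u \in (<[n]> + <[u]>)%VS) ->
    rho (gen i) v - a *: v \in (<[n]> + <[u]>)%VS ->
    rho (gen j) v - b *: v \in (<[n]> + <[u]>)%VS ->
  exists s t, let v' := v - (s *: n + t *: u) in
    rho (gen i) v' = a *: v' /\ rho (gen j) v' = b *: v'.
Proof.
set N := (_ + _)%VS => En Eu vi vj.
have [l [h [k [li lj one stab]]]] := rep_split a b.
have stN k' : k' \in [:: i; j] -> {in N, forall v, rho (gen k') v \in N}.
  move=> kij w Nw; rewrite rho_proj_gen memvB // memvZ //.
  have /memv_addP[_ /vlineP[c ->] [_ /vlineP[d ->] ->]] := Nw.
  by rewrite proj_genD !proj_genZ memvD // memvZ ?En ?Eu.
have [||hv _] := stab N _ _ _ vi; try by apply: stN; rewrite !inE eqxx ?orbT.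
have [||_ kv] := stab N _ _ _ vj; try by apply: stN; rewrite !inE eqxx ?orbT.
have /memv_addP[_ /vlineP[s ->] [_ /vlineP[t ->] e]] := memvD hv kv.
exists s, t => v'; suff -> : v' = l v by split.
by rewrite /v' -e {1}(one v) addrC addKr.
Qed.

(* The quotient of the span of [v], [E j v - v] and [E i (E j v) - v] by the last
   two is the index representation, which splits off by semisimplicity. *)
Lemma proj_gen_fixed v : E i v = v -> let u := E i (E j v) - v in E j u = u ->
  E j v = v.
Proof.
move=> vi u uj; set z := E j v - v.
have ui : E i u = u by rewrite proj_genB proj_genK vi.
have zi : E i z = u by rewrite proj_genB vi.
have zj : E j z = 0 by rewrite proj_genB proj_genK subrr.
have Nz : z \in (<[z]> + <[u]>)%VS by rewrite (subvP (addvSl _ _)) ?memv_line.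
have Nu : u \in (<[z]> + <[u]>)%VS by rewrite (subvP (addvSr _ _)) ?memv_line.
have rq k w : rho (gen k) w - q *: w = (q + 1) *: (E k w - w).
  rewrite rho_proj_gen scalerBr -addrA -opprD; congr (_ - _).
  by rewrite scalerDl scale1r addrC.
have [||||s [t [/eqP fi /eqP fj]]] := @rep_split_line z u v q q.
- by move=> k; rewrite !inE => /orP[] /eqP->; rewrite ?zi ?zj ?mem0v.
- by move=> k; rewrite !inE => /orP[] /eqP->; rewrite ?ui ?uj.
- by rewrite rq vi subrr scaler0 mem0v.
- by rewrite rq memvZ.
move: fi fj; rewrite !rho_eigen_proj divff // !scale1r !proj_genB !proj_genD.
rewrite !proj_genZ vi zi ui zj uj scaler0 add0r => /eqP fi /eqP fj.
have e1 : s *: u = s *: z by move/addrI/oppr_inj/addIr: fi.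
have e2 : z = - (s *: z).
  apply: (addrI v); rewrite [v + z]addrC subrK; apply: (addIr (- (t *: u))).
  by rewrite fj opprD addrA.
suff /eqP : z = 0 by rewrite subr_eq0 => /eqP.
have /eqP : (1 + s) *: z = 0 by rewrite scalerDl scale1r {1}e2 addNr.
rewrite scaler_eq0 addrC addr_eq0 => /orP[/eqP sN1 | /eqP //].
move: e1; rewrite sN1 !scaleN1r => /oppr_inj uz.
by rewrite -uz -uj uz zj.
Qed.

Lemma proj_gen_null v : E i v = v -> E i (E j v) = 0 -> E j v = 0.
Proof.
move=> vi; set w := E j v => wi.
have wj : E j w = w by rewrite proj_genK.
have Nw : w \in (<[w]> + <[0]>)%VS by rewrite (subvP (addvSl _ _)) ?memv_line.
have E0 k : E k 0 = 0 by rewrite /proj_gen linear0 addr0 scaler0.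
have [||||s [t [/eqP fi /eqP fj]]] := @rep_split_line w 0 v q (-1).
- by move=> k; rewrite !inE => /orP[] /eqP->; rewrite ?wi ?wj ?mem0v.
- by move=> k _; rewrite E0 mem0v.
- by rewrite rho_proj_gen vi scalerDl scale1r addrK subrr mem0v.
- by rewrite rho_proj_gen scaleN1r opprK subrK memvZ.
move: fi fj; rewrite !rho_eigen_proj divff // addNr mul0r scale0r scale1r scaler0 addr0.
rewrite !proj_genB !(proj_genZ _ s) vi wi wj scaler0 subr0 => /eqP fi.
have -> : s *: w = 0 by apply: oppr_inj; apply: (addrI v); rewrite -fi oppr0 addr0.
by rewrite subr0 => /eqP.
Qed.

Local Notation T := (jump rho j i \o jump rho i j)%VF.

Lemma jump2E u : vsval (T u) = E i (E j (vsval u)).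
Proof. by rewrite lfunE /= !jumpE. Qed.

Local Notation th := (theta q (gen i) (gen j)).

Lemma rho_theta (u : subvs_of (Vq rho i)) : rho th (vsval u) = vsval (T u).
Proof.
rewrite jump2E; set v := vsval u.
have vi : E i v = v by apply/eqP; rewrite -proj_gen_id subvsP.
apply: (scalerI p_neq0); rewrite -linearZ /= -{1}vi -rho_succ -rhoM.
rewrite theta_mul_succ; try exact: hecke_quadP.
rewrite rhoZ !rhoM !rho_succ vi (proj_genZ j _ v) 2!(proj_genZ i (q + 1)).
rewrite !scalerA; congr (_ *: _).
by field.
Qed.

Lemma kill_theta (rs : seq K) (u : subvs_of (Vq rho i)) :
  vsval (kill T rs u) =
  rho (horner_alg th (\prod_(r <- rs) ('X - r%:P))) (vsval u).
Proof.
elim: rs u => [|r rs IHrs] u; first by rewrite big_nil rmorph1 rho_1.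
rewrite kill_cons IHrs big_cons mulrC rmorphM rhoM rmorphB /= horner_algX horner_algC.
by rewrite (rhoB th r%:A) (rhoZ r 1) rho_1 rho_theta.
Qed.

Lemma kill_perm rs rs' u : perm_eq rs rs' -> kill T rs u = kill T rs' u.
Proof. by move=> prs; apply: val_inj; rewrite /= !kill_theta (perm_big _ prs). Qed.

Lemma jump_fixed u : T u = u -> vsval u \in (Vq rho i :&: Vq rho j)%VS.
Proof.
move=> Tu; have ui : E i (vsval u) = vsval u by apply/eqP; rewrite -proj_gen_id subvsP.
have Eu : E i (E j (vsval u)) = vsval u by rewrite -jump2E Tu.
rewrite memv_cap; apply/andP; split; first exact: subvsP.
rewrite (proj_gen_id j); apply/eqP/(proj_gen_fixed ui).
by rewrite Eu subrr /proj_gen linear0 addr0 scaler0.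
Qed.

Lemma jump_ker1 u : T (T u - u) = T u - u -> T u = u.
Proof.
move=> /jump_fixed; rewrite memv_cap => /andP[_].
rewrite proj_gen_id linearB /= jump2E => /eqP uj.
have ui : E i (vsval u) = vsval u by apply/eqP; rewrite -proj_gen_id subvsP.
by apply: val_inj; rewrite /= jump2E (proj_gen_fixed ui uj).
Qed.

Variable c : nat -> nat -> K.
Hypotheses (q0 : q != 0) (m2 : (2 <= M i j)%N) (hc : four_cos_sq (M i j) (c (M i j))).

Local Notation m := (M i j).
Let rs := [seq lambda c m q a | a <- iota 1 ((m - 1) %/ 2)] ++ nseq (~~ odd m) 0.

Lemma mem_jump_eigenvalues r : r \in rs ->
  (exists a, (1 <= a <= (m - 1) %/ 2)%N /\ r = lambda c m q a) \/ ~~ odd m /\ r = 0.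
Proof.
rewrite mem_cat => /orP[/mapP[a] | ].
  by rewrite mem_iota add1n ltnS => ha ->; left; exists a.
by rewrite mem_nseq lt0b => /andP[om /eqP ->]; right.
Qed.

Lemma uniq_jump_eigenvalues : uniq rs.
Proof.
have inh a : a \in iota 1 ((m - 1) %/ 2) -> (0 < a <= (m - 1) %/ 2)%N.
  by rewrite mem_iota add1n ltnS.
rewrite cat_uniq map_inj_in_uniq ?iota_uniq //=; last first.
  by move=> a b /inh ha /inh hb; apply: (lambda_inj q0 q1 hc).
apply/andP; split; last by case: (odd m).
apply/hasPn => r; rewrite mem_nseq => /andP[_ /eqP ->].
by apply/mapP => -[a /inh /(lambda_neq0 q0 q1 hc)] /[swap] <-; rewrite eqxx.
Qed.

Lemma kill_jump u : kill T (rcons rs 1) u = 0.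
Proof.
have m0 : (0 < m)%N by apply: ltn_trans m2.
apply: val_inj; rewrite /= kill_theta -cats1 !big_cat /= big_seq1.
have -> : \prod_(r <- nseq (~~ odd m) 0) ('X - r%:P) = 'X ^+ (~~ odd m) :> {poly K}.
  by case: (odd m); rewrite ?big_nil // big_seq1 subr0.
have := braid_annihilator (hecke_quadP M q i) (hecke_quadP M q j) q1 m2
  (hecke_braidP M q ij).
rewrite (braid_poly_factor q0 q1 hc m0) -!scalerAl linearZ /= mulr_algl -scalerAl.
move/eqP; rewrite scaler_eq0 (negPf (lead_coef_braid_poly_neq0 q1 m0)) /= => /eqP ann.
have /eqP := congr1 (fun z => rho z (vsval u)) ann.
have /eqP ui : E i (vsval u) == vsval u by rewrite -proj_gen_id subvsP.
rewrite rhoM rho_succ ui linearZ rho0 /= scaler_eq0 (negPf p_neq0) /= => /eqP.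
exact.
Qed.

Lemma kill_jump_uniq u : kill T (rcons (rem 1 rs) 1) u = 0.
Proof.
have [rs1 | /rem_id -> ] := boolP (1 \in rs); last exact: kill_jump.
have := kill_jump u; rewrite (@kill_perm _ (rcons (rcons (rem 1 rs) 1) 1)); last first.
  by rewrite perm_rcons perm_sym perm_rcons perm_cons perm_rcons perm_sym perm_to_rem.
rewrite !kill_rcons !scale1r => /eqP; rewrite subr_eq0 => /eqP /jump_ker1 ->.
by rewrite subrr.
Qed.

Lemma jump_diagonalizable : lfun_diagonalizable T.
Proof.
apply: kill_diagonalizable kill_jump_uniq.
rewrite rcons_uniq rem_uniq ?uniq_jump_eigenvalues //.
by rewrite mem_rem_uniq ?uniq_jump_eigenvalues // inE eqxx.
Qed.

Lemma jump_eigenvalue r : passmx.leigenvalue T r -> r = 1 \/ r \in rs.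
Proof.
move/(kill_leigenvalue kill_jump_uniq); rewrite mem_rcons inE.
by move=> /orP[/eqP-> | /mem_rem]; [left | right].
Qed.

End Representation.

Theorem theorem1p2 (K : fieldType) (I : finType) (M : I -> I -> nat)
    (hM : coxeter_matrix M)
    (c : nat -> nat -> K)
    (hc : forall i j : I, i != j -> four_cos_sq (M i j) (c (M i j)))
    (q : K) (hq : generic M q)
    (V : vectType K) (rho : representation (hecke M q) V)
    (i j : I) (hij : i != j) :
  let m := M i j in
  let T : 'End(subvs_of (Vq rho i)) := (jump rho j i \o jump rho i j)%VF in
  let is_lambda (x : K) :=
    exists a : nat, (1 <= a <= (m - 1) %/ 2)%N /\ x = lambda c m q a in
  [/\ odd m ->
        lfun_diagonalizable T /\
        (forall x : K, passmx.leigenvalue T x -> x = 1 \/ is_lambda x),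
      ~~ odd m ->
        [/\ lfun_diagonalizable T,
            forall x : K, passmx.leigenvalue T x -> x = 1 \/ x = 0 \/ is_lambda x
          & forall u : subvs_of (Vq rho i),
              u != 0 -> u \in passmx.leigenspace T 0 -> jump rho i j u = 0]
    & forall v : subvs_of (Vq rho i), v != 0 ->
        (v \in passmx.leigenspace T 1 <-> vsval v \in (Vq rho i :&: Vq rho j)%VS)].
Proof.
move=> m T is_lambda.
have [_ Msym M2] := hM; have [q0 ss] := hq.
have Mji := Msym j i; have m2 := M2 i j hij; have ssij := ss i j hij.
have hcij := hc i j hij.
have q1 := semisimple_dihedral_neqN1 ssij.
have diagT : lfun_diagonalizable T.
  by apply: (jump_diagonalizable rho q1 hij Mji ssij q0 m2 hcij).
have eigT x : passmx.leigenvalue T x -> x = 1 \/ is_lambda x \/ ~~ odd m /\ x = 0.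
  move/(jump_eigenvalue q1 hij Mji ssij q0 m2 hcij).
  move=> [-> | /mem_jump_eigenvalues]; first by left.
  by right.
split.
- move=> om; split=> // x /eigT [-> | [|[]]]; [by left | by right | by rewrite om].
- move=> em; split=> //.
    by move=> x /eigT [-> | [|[_ ->]]]; [left | right; right | right; left].
  move=> u _; rewrite mem_leigenspace scale0r => /eqP Tu.
  apply: val_inj; rewrite /= (jumpE q1); apply: (proj_gen_null q1 hij Mji ssij).
    by apply/eqP; rewrite -(proj_gen_id rho q1) subvsP.
  by rewrite -(jump2E q1) Tu.
- move=> v _; rewrite mem_leigenspace scale1r; split => [/eqP | ].
    exact: (jump_fixed q1 hij Mji ssij).
  rewrite memv_cap (proj_gen_id rho q1 i) (proj_gen_id rho q1 j).
  move=> /andP[/eqP vi /eqP vj].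
  by apply/eqP/val_inj; rewrite /= (jump2E q1) vj vi.
Qed.
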